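(* Let $p_0$ denote the input data distribution on $\mathbb{R}^n$ and let $p_t$, for $t>0$, denote the intermediate marginal distributions of the diffusion process with noise levels $\sigma_t$. Let $\mathrm{H}\in\mathbb{R}^{m\times n}$ be a linear degradation matrix, $\mathbf{y}\in\mathbb{R}^m$ a measurement, and $\sigma_{\mathbf{y}}^2$ the measurement noise variance. Suppose there exist $\tau>0$ and $d>0$ such that, for all $0<t<\tau$, $p_t\in C^2$ (twice continuously differentiable) and $\|\mathbf{x}\|\le d$ (in other words, for all $0<t<\tau$, $p_t\in C^2$ and $\|\mathbf{x}_t\|\le d$ for $\mathbf{x}_t\in\mathcal{M}_t$, the intermediate diffusion manifold at time $t$). Assume sufficient conditions for $\lim_{t\to0}\log p_t(\mathbf{x})=\log p_0(\mathbf{x})$, i.e. assume that this limit holds for the points $\mathbf{x}$ considered. Let, for $t>0$, $$\begin{aligned}\mathrm{VML}_t(\mathbf{x})={}&-\log p_t(\mathbf{x})-\frac{\sigma_t^2}{2}\|\nabla_{\mathbf{x}}\log p_t(\mathbf{x})\|^2-\frac{\sigma_t^2}{2}\mathrm{Tr}\{\nabla^2_{\mathbf{x}}\log p_t(\mathbf{x})\}+\frac{\|\mathbf{y}-\mathrm{H}\mathrm{D}(\mathbf{x},t)\|^2}{2\sigma_{\mathbf{y}}^2}\\&+\frac{\sigma_t^4}{2\sigma_{\mathbf{y}}^2}\mathrm{Tr}\{\mathrm{H}\nabla^2_{\mathbf{x}}\log p_t(\mathbf{x})\mathrm{H}^{\top}\}+\frac{\sigma_t^2}{2\sigma_{\mathbf{y}}^2}\mathrm{Tr}\{\mathrm{H}\mathrm{H}^{\top}\}+\log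 p(\mathbf{y})-n\log\sigma_t+\mathrm{C}_{\mathrm{VML}},\end{aligned}$$ where $\mathrm{C}_{\mathrm{VML}}=-\frac n2+m\log\sigma_{\mathbf{y}}-\frac{n-m}{2}\log 2\pi$. Then $\mathrm{VML}_t(\mathbf{x})+n\log\sigma_t$ converges pointwise as $t\to0$: $$\lim_{t\to0}\big(\mathrm{VML}_t(\mathbf{x})+n\log\sigma_t\big)=-\log p_0(\mathbf{x}\mid\mathbf{y})+\hat{\mathrm{C}}_{\mathrm{VML}}\qquad\text{for all }\mathbf{x}\text{ with }\|\mathbf{x}\|\le d,$$ where $\hat{\mathrm{C}}_{\mathrm{VML}}=-\frac n2-\frac n2\log2\pi$.
   Context: The noise schedule satisfies $\sigma_t>0$ for $t>0$ and $\sigma_t\to0$ as $t\to0$. The diffusion kernel is $p(\mathbf{x}_t\mid\mathbf{x}_0)=\mathcal{N}(\mathbf{x}_0,\sigma_t^2\mathbf{I})$, and $p_t$ is the resulting marginal density of $\mathbf{x}_t$ when $\mathbf{x}_0\sim p_0$; densities are identified with distributions. The true denoiser is $\mathrm{D}(\mathbf{x},t)=\mathbb{E}[\mathbf{x}_0\mid\mathbf{x}_t=\mathbf{x}]=\mathbf{x}+\sigma_t^2\nabla_{\mathbf{x}}\log p_t(\mathbf{x})$. The measurement model is $p_0(\mathbf{y}\mid\mathbf{x})=\mathcal{N}(\mathrm{H}\mathbf{x},\sigma_{\mathbf{y}}^2\mathbf{I})$, $p(\mathbf{y})=\int p_0(\mathbf{y}\mid\mathbf{x})p_0(\mathbf{x})\,d\mathbf{x}$,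 and $p_0(\mathbf{x}\mid\mathbf{y})=p_0(\mathbf{y}\mid\mathbf{x})p_0(\mathbf{x})/p(\mathbf{y})$. $\nabla^2_{\mathbf{x}}$ denotes the Hessian and $\mathrm{Tr}$ the trace. (The function $\mathrm{VML}_t(\mathbf{x})$ is the variational mode-seeking loss $D_{\mathrm{KL}}(p(\mathbf{x}_0\mid\mathbf{x}_t=\mathbf{x})\,\|\,p(\mathbf{x}_0\mid\mathbf{y}))$ written in terms of $\log p_t$.)
   Formalization: The noise schedule σ_t is additionally assumed continuous for t>0, since for schedules taking only a sequence of values the claim can fail; the points x considered are those with p_0(x)>0, so that log p_0(x) is finite. *)

(* Defs.v *)
From HB Require Import structures.
From mathcomp Require Import all_boot all_order all_algebra.
From mathcomp Require Import all_classical all_reals all_analysis.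

Set Implicit Arguments.
Unset Strict Implicit.
Unset Printing Implicit Defensive.
Import Order.TTheory GRing.Theory Num.Theory.
Import numFieldNormedType.Exports.

Local Open Scope classical_set_scope.
Local Open Scope ring_scope.

(* Points of R^n are column vectors 'cV[R]_n. *)

(* The Borel sigma-algebra of R^(m x n), generated by the coordinate maps. *)
Section measurable_matrix.
Variables (R : realType) (m n : nat).

Definition mx_cylinder : set (set 'M[R]_(m, n)) :=
  [set A | exists i j (B : set (measurableTypeR R)),
     measurable B /\ A = [set M : 'M[R]_(m, n) | B (M i j)]].

Let mx_set0 : <<s mx_cylinder >> set0.
Proof. exact: sigma_algebra0. Qed.

Let mx_setC A : <<s mx_cylinder >> A -> <<s mx_cylinder >> (~` A).
Proof. exact: sigma_algebraC. Qed.

Let mx_bigcup (F : (set 'M[R]_(m, n))^nat) :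
  (forall i, <<s mx_cylinder >> (F i)) -> <<s mx_cylinder >> (\bigcup_i F i).
Proof. exact: sigma_algebra_bigcup. Qed.

HB.instance Definition _ := @isMeasurable.Build (sigma_display mx_cylinder)
  'M[R]_(m, n) <<s mx_cylinder >> mx_set0 mx_setC mx_bigcup.

Lemma measurable_coord i j :
  measurable_fun setT (fun M : 'M[R]_(m, n) => M i j : measurableTypeR R).
Proof.
move=> _ B mB; rewrite setTI; apply: sub_sigma_algebra.
by exists i, j, B.
Qed.

Lemma measurable_fun_mxP d (T : measurableType d) (f : T -> 'M[R]_(m, n)) :
  measurable_fun setT f <->
  forall i j, measurable_fun setT (fun x => f x i j : measurableTypeR R).
Proof.
split=> [mf i j|mf].
  exact: (measurableT_comp (measurable_coord i j) mf).
apply: (measurability mx_cylinder) => //.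
move=> _ [_ [i [j [B [mB ->]]]] <-].
exact: mf.
Qed.

End measurable_matrix.

Section lebesgue_Rn.
Variable R : realType.

Definition ccons n (p : measurableTypeR R * 'cV[R]_n) : 'cV[R]_n.+1 :=
  col_mx (p.1 : R)%:M p.2 : 'cV[R]_(1 + n).

Lemma ccons0 n (p : measurableTypeR R * 'cV[R]_n) j : ccons p ord0 j = p.1.
Proof.
rewrite /ccons mxE; case: splitP => // k _.
by rewrite !ord1 mxE eqxx.
Qed.

Lemma cconsS n (p : measurableTypeR R * 'cV[R]_n) k j :
  ccons p (lift ord0 k) j = p.2 k j.
Proof.
rewrite /ccons mxE; case: splitP => [[[|//] ?]//|l].
by rewrite lift0 add1n => -[kl]; congr (p.2 _ _); exact: val_inj.
Qed.

Lemma measurable_ccons n : measurable_fun setT (@ccons n).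
Proof.
apply/measurable_fun_mxP => i j.
case: (unliftP ord0 i) => [k|] ->.
  under eq_fun do rewrite cconsS.
  exact: (measurableT_comp (measurable_coord k j)).
by under eq_fun do rewrite ccons0; exact: measurable_fst.
Qed.

Section lebesgue_step.
Variables (n : nat) (mu : {sigma_finite_measure set 'cV[R]_n -> \bar R}).

Let mcc := @measurable_ccons n.

Definition lebesgue_step : set 'cV[R]_n.+1 -> \bar R :=
  pushforward (@lebesgue_measure R \x mu)%E (@ccons n).

Let step0 : lebesgue_step set0 = 0%E.
Proof. exact: (@measure0 _ _ _ (pushforward _ _)). Qed.

Let step_ge0 A : (0 <= lebesgue_step A)%E.
Proof. exact: (@measure_ge0 _ _ _ (pushforward _ _)). Qed.

Let step_sigma_additive : semi_sigma_additive lebesgue_step.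
Proof. exact: (@measure_semi_sigma_additive _ _ _ (pushforward _ _)). Qed.

HB.instance Definition _ := isMeasure.Build _ _ _ lebesgue_step
  step0 step_ge0 step_sigma_additive.

Let uncons (v : 'cV[R]_n.+1) : measurableTypeR R * 'cV[R]_n :=
  (v ord0 ord0, \col_i v (lift ord0 i) ord0).

Let muncons : measurable_fun setT uncons.
Proof.
apply: measurable_fun_pair => /=; first exact: measurable_coord.
apply/measurable_fun_mxP => i j.
rewrite (_ : (fun _ => _) = (fun v : 'cV[R]_n.+1 => v (lift ord0 i) ord0)).
  exact: measurable_coord.
by apply/funext => v; rewrite mxE.
Qed.

Let cconsK : cancel (@ccons n) uncons.
Proof.
move=> [a v]; rewrite /uncons ccons0; congr pair.
by apply/colP => k; rewrite mxE cconsS.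
Qed.

Let step_sigma_finite : sigma_finite setT lebesgue_step.
Proof.
have /sigma_finiteP[F [TF ndF Foo]] := sigma_finiteT (@lebesgue_measure R).
have /sigma_finiteP[G [TG ndG Goo]] := sigma_finiteT mu.
exists (fun k => uncons @^-1` (F k `*` G k)).
  rewrite -preimage_bigcup -[LHS](preimage_setT uncons); congr (_ @^-1` _).
  rewrite -setXTT TF TG predeqE => -[x v]; split.
    move=> [/= [k _ Fkx] [l _ Glv]]; exists (maxn k l) => //; split.
    - by move: x Fkx; exact/subsetPset/ndF/leq_maxl.
    - by move: v Glv; exact/subsetPset/ndG/leq_maxr.
  by move=> [k _ []/= ? ?]; split; exists k.
move=> k; have [mF Fk] := Foo k; have [mG Gk] := Goo k; split.
  by rewrite -[X in measurable X]setTI; apply: muncons => //; exact: measurableX.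
rewrite /lebesgue_step /pushforward -comp_preimage.
rewrite (_ : uncons \o _ = id); last by apply/funext => p /=; rewrite cconsK.
by rewrite preimage_id product_measure1E// lte_mul_pinfty// ge0_fin_numE.
Qed.

HB.instance Definition _ := Measure_isSigmaFinite.Build _ _ _ lebesgue_step
  step_sigma_finite.

End lebesgue_step.

(* Lebesgue measure on R^n: the n-fold product of Lebesgue measure on R. *)
Fixpoint lebesgue_Rn n : {sigma_finite_measure set 'cV[R]_n -> \bar R} :=
  match n with
  | 0 => @dirac _ 'cV[R]_0 0 R
  | k.+1 => lebesgue_step (lebesgue_Rn k)
  end.

Lemma lebesgue_Rn_box n (A : 'I_n -> set (measurableTypeR R)) :
  (forall i, measurable (A i)) ->
  lebesgue_Rn n [set x | forall i, A i (x i ord0)] =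
  (\prod_i lebesgue_measure (A i))%E.
Proof.
elim: n A => [|n IHn] A mA.
  rewrite big_ord0 [LHS]diracE mem_set//=.
  by case.
have mbox : measurable [set v : 'cV[R]_n | forall i, A (lift ord0 i) (v i ord0)].
  rewrite (_ : mkset _ = \bigcap_(i in [set: 'I_n])
    ((fun x : 'cV[R]_n => x i ord0) @^-1` A (lift ord0 i))).
    apply: fin_bigcap_measurable => // i _.
    by rewrite -[X in measurable X]setTI; exact: measurable_coord.
  by apply/seteqP; split => [x Ax i _|x Ax i]; [exact: Ax|exact: Ax].
rewrite big_ord_recl -IHn// -product_measure1E//.
congr (product_measure1 _ _ _); apply/seteqP; split => -[x v] /=.
  move=> Axv; split; first by have := Axv ord0; rewrite ccons0.
  by move=> i; have := Axv (lift ord0 i); rewrite cconsS.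
move=> [Ax Av] i; case: (unliftP ord0 i) => [k|] ->; first by rewrite cconsS.
by rewrite ccons0.
Qed.

End lebesgue_Rn.
Arguments lebesgue_Rn {R} n.

Section definitions.
Variable R : realType.

(* The library norm on matrices is the sup norm. *)
Definition l2norm n (x : 'cV[R]_n) : R := Num.sqrt (\sum_i (x i 0) ^+ 2).

Definition evec n (i : 'I_n) : 'cV[R]_n := delta_mx i 0.

Definition gradient n (f : 'cV[R]_n -> R) (x : 'cV[R]_n) : 'cV[R]_n :=
  \col_i 'D_(evec i) f x.

Definition hessian n (f : 'cV[R]_n -> R) (x : 'cV[R]_n) : 'M[R]_n :=
  \matrix_(i, j) 'D_(evec i) ('D_(evec j) f) x.

Definition C2 n (f : 'cV[R]_n -> R) : Prop :=
  [/\ continuous f,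
      (forall i, (forall x, derivable f x (evec i)) /\
                 continuous ('D_(evec i) f)) &
      (forall i j, (forall x, derivable ('D_(evec j) f) x (evec i)) /\
                   continuous ('D_(evec i) ('D_(evec j) f)))].

Definition is_density n (p : 'cV[R]_n -> R) : Prop :=
  [/\ measurable_fun setT p, (forall x, 0 <= p x) &
      (\int[lebesgue_Rn n]_x (p x)%:E = 1)%E].

(* Density at x of the Gaussian N(mu, s^2 I) on R^k. *)
Definition gauss k (mu : 'cV[R]_k) (s : R) (x : 'cV[R]_k) : R :=
  (2 * pi * s ^+ 2) `^ (- (k%:R / 2)) *
  expR (- (l2norm (x - mu) ^+ 2 / (2 * s ^+ 2))).

Section diffusion.
Variables (n : nat) (p0 : 'cV[R]_n -> R).

(* Density of x_t = x_0 + s * noise, where s = sigma_t and x_0 ~ p0. *)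
Definition marginal (s : R) (x : 'cV[R]_n) : R :=
  \int[lebesgue_Rn n]_x0 (gauss x0 s x * p0 x0).

(* The conditional density p(x_0 | x_t = x) at noise level s. *)
Definition denoising_posterior (s : R) (x x0 : 'cV[R]_n) : R :=
  gauss x0 s x * p0 x0 / marginal s x.

(* E[x_0 | x_t = x] at noise level s. *)
Definition denoiser (s : R) (x : 'cV[R]_n) : 'cV[R]_n :=
  \col_i \int[lebesgue_Rn n]_x0 (x0 i 0 * denoising_posterior s x x0).

Section measurement.
Variables (m : nat) (H : 'M[R]_(m, n)) (sy : R) (y : 'cV[R]_m).

Definition likelihood (x : 'cV[R]_n) : R := gauss (H *m x) sy y.

Definition evidence : R := \int[lebesgue_Rn n]_x (likelihood x * p0 x).

Definition posterior (x : 'cV[R]_n) : R := likelihood x * p0 x / evidence.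

Definition CVML : R :=
  - (n%:R / 2) + m%:R * ln sy - (n%:R - m%:R) / 2 * ln (2 * pi).

Definition CVML_hat : R := - (n%:R / 2) - n%:R / 2 * ln (2 * pi).

(* VML_t(x), as a function of the noise level s = sigma_t. *)
Definition VML (s : R) (x : 'cV[R]_n) : R :=
  let logp := fun z => ln (marginal s z) in
  - logp x
  - s ^+ 2 / 2 * l2norm (gradient logp x) ^+ 2
  - s ^+ 2 / 2 * \tr (hessian logp x)
  + l2norm (y - H *m denoiser s x) ^+ 2 / (2 * sy ^+ 2)
  + s ^+ 4 / (2 * sy ^+ 2) * \tr (H *m hessian logp x *m H^T)
  + s ^+ 2 / (2 * sy ^+ 2) * \tr (H *m H^T)
  + ln evidence - n%:R * ln s + CVML.

End measurement.
End diffusion.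

(* A schedule is continuous, as for any diffusion process. This matters: if
   sigma only took the values of a sequence s_k -> 0, then convergence of
   log p_t(x) along that sequence would not control s_k^2 times the Laplacian
   of p_t at x. *)
Definition noise_schedule (sigma : R -> R) : Prop :=
  [/\ forall t, 0 < t -> 0 < sigma t,
      forall t, 0 < t -> {for t, continuous sigma} &
      sigma t @[t --> 0^'+] --> (0 : R)].

End definitions.

(* Main.v *)
Require Import Defs.
From HB Require Import structures.
From mathcomp Require Import all_boot all_order all_algebra.
From mathcomp Require Import all_classical all_reals all_analysis.
From mathcomp Require Import measurable_realfun ring lra.
Import Order.TTheory GRing.Theory Num.Theory.
Import numFieldNormedType.Exports.
Local Open Scope classical_set_scope.
Local Open Scope ring_scope.

(* Write g_s(z) = exp(-|x - z|^2 / (2 s^2)), M(s) = int g_s p0 and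
   B(s) = int |x - z|^2 g_s(z) p0(z) dz.  Differentiating under the integral
   sign expresses the gradient and the Hessian of log p_t through the first and
   second moments of z - x under g_s p0; in particular
     s^2 (|grad log p_t|^2 + Tr hess log p_t) = B / (s^2 M) - n.
   The heart of the matter is that pointwise convergence of p_t at x alone
   forces B / (s^2 M) --> n.  This is a Tauberian argument: M is convex in
   1/(2 s^2) with derivative -B, so B is squeezed between difference quotients
   of M, and p_t(x) --> L > 0 gives M(k s) / M(s) --> k^n for each k > 0; then
   let k --> 1 from both sides.  The remaining moments are bounded by B, hence
   the denoiser tends to x and s^4 hess log p_t tends to 0. *)

(** * Integration of bounded functions against a probability density *)

Section weighted_integral.
Context {R : realType} {d : measure_display} {T : measurableType d}.
Implicit Types (K L : T -> R).

(** Boundedness stands in for integrability: against a weight of total mass one it implies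
    integrability, and unlike integrability it is stable under products. *)
Definition bounded_mfun K :=
  measurable_fun setT K /\ exists C, forall x, `|K x| <= C.

Lemma bounded_mfun_cst c : bounded_mfun (fun=> c).
Proof. by split=> //; exists `|c|. Qed.

Lemma bounded_mfunD K L :
  bounded_mfun K -> bounded_mfun L -> bounded_mfun (fun x => K x + L x).
Proof.
move=> [mK [C KC]] [mL [D LD]]; split; first exact: measurable_funD.
by exists (C + D) => x; rewrite (le_trans (ler_normD _ _))// lerD.
Qed.

Lemma bounded_mfunM K L :
  bounded_mfun K -> bounded_mfun L -> bounded_mfun (fun x => K x * L x).
Proof.
move=> [mK [C KC]] [mL [D LD]]; split; first exact: measurable_funM.
by exists (C * D) => x; rewrite normrM ler_pM.
Qed.

Lemma bounded_mfunZ c K : bounded_mfun K -> bounded_mfun (fun x => c * K x).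
Proof. exact/bounded_mfunM/bounded_mfun_cst. Qed.

Lemma bounded_mfunB K L :
  bounded_mfun K -> bounded_mfun L -> bounded_mfun (fun x => K x - L x).
Proof.
move=> bK /(bounded_mfunZ (-1)) bL.
by have := bounded_mfunD _ _ bK bL; under eq_fun do rewrite mulN1r.
Qed.

Lemma bounded_mfun_sum (I : Type) (r : seq I) (F : I -> T -> R) :
  (forall i, bounded_mfun (F i)) -> bounded_mfun (fun x => \sum_(i <- r) F i x).
Proof.
move=> bF; elim: r => [|i r IHr].
  by under eq_fun do rewrite big_nil; exact: bounded_mfun_cst.
by under eq_fun do rewrite big_cons; exact: bounded_mfunD.
Qed.

Variables (mu : {measure set T -> \bar R}) (w : T -> R).
Hypothesis mw : measurable_fun setT w.
Hypothesis w_ge0 : forall x, 0 <= w x.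
Hypothesis w1 : (\int[mu]_x (w x)%:E = 1)%E.

Definition wint K : R := \int[mu]_x (K x * w x).

Lemma weight_integrable : mu.-integrable setT (EFin \o w).
Proof.
apply/integrableP; split; first exact/measurable_EFinP.
under eq_integral do rewrite /= ger0_norm//.
by rewrite w1 ltry.
Qed.

Lemma wint_integrable K :
  bounded_mfun K -> mu.-integrable setT (EFin \o (fun x => K x * w x)).
Proof.
move=> [mK [C KC]].
have C0 : 0 <= `|C| by [].
apply: (@le_integrable _ _ _ mu _ _ _ (EFin \o (fun x => `|C| * w x))) => //.
- by apply/measurable_EFinP; exact: measurable_funM.
- move=> x _ /=; rewrite lee_fin !normrM ler_wpM2r// normr_id.
  exact: le_trans (KC x) (ler_norm _).
- have := integrableZl measurableT `|C| weight_integrable.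
  by apply: eq_integrable => // x _ /=; rewrite EFinM.
Qed.

Lemma wintZ c K : bounded_mfun K -> wint (fun x => c * K x) = c * wint K.
Proof.
move=> bK; rewrite /wint -RintegralZl//; last exact: wint_integrable.
by apply: eq_Rintegral => x _; rewrite mulrA.
Qed.

Lemma wintD K L : bounded_mfun K -> bounded_mfun L ->
  wint (fun x => K x + L x) = wint K + wint L.
Proof.
move=> bK bL; rewrite /wint -RintegralD//; [|exact: wint_integrable..].
by apply: eq_Rintegral => x _; rewrite mulrDl.
Qed.

Lemma wintB K L : bounded_mfun K -> bounded_mfun L ->
  wint (fun x => K x - L x) = wint K - wint L.
Proof.
move=> bK bL; rewrite /wint -RintegralB//; [|exact: wint_integrable..].
by apply: eq_Rintegral => x _; rewrite mulrBl.
Qed.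

Lemma wint_sum (I : Type) (r : seq I) (F : I -> T -> R) :
  (forall i, bounded_mfun (F i)) ->
  wint (fun x => \sum_(i <- r) F i x) = \sum_(i <- r) wint (F i).
Proof.
move=> bF; elim: r => [|i r IHr].
  rewrite big_nil /wint; under eq_Rintegral do rewrite big_nil mul0r.
  by rewrite Rintegral_cst// mul0r.
rewrite big_cons -IHr -wintD//; last exact: bounded_mfun_sum.
by congr wint; apply/funext => x; rewrite big_cons.
Qed.

Lemma le_wint K L : bounded_mfun K -> bounded_mfun L ->
  (forall x, K x <= L x) -> wint K <= wint L.
Proof.
move=> bK bL KL; apply: le_Rintegral => //; [exact: wint_integrable..|].
by move=> x _; rewrite ler_wpM2r.
Qed.

(** If the integral vanished, [K * w] would be zero almost everywhere; as [K] never vanishes, so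
    would [w], against its total mass one. *)
Lemma wint_gt0 K : bounded_mfun K -> (forall x, 0 < K x) -> 0 < wint K.
Proof.
move=> bK K0; have mKw := (integrableP _ _ _ (wint_integrable _ bK)).1.
rewrite lt_def Rintegral_ge0 ?andbT; last by move=> x _; rewrite mulr_ge0// ltW.
apply/eqP => Kw0.
have : (\int[mu]_x `|(K x * w x)%:E| = 0)%E.
  have -> : (\int[mu]_x `|(K x * w x)%:E| = \int[mu]_x (K x * w x)%:E)%E.
    by apply: eq_integral => x _; rewrite gee0_abs// lee_fin mulr_ge0// ltW.
  rewrite -(fineK (integrable_fin_num _ (wint_integrable _ bK)))//.
  by congr (_%:E).
move=> /(ae_eq_integral_abs mu measurableT mKw) Kw_ae.
have : (\int[mu]_x (w x)%:E = \int[mu]_x (cst 0 x))%E.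
  apply: ae_eq_integral => //; first exact/measurable_EFinP.
  apply: filterS Kw_ae => x /(_ I) /= -[] /eqP.
  by rewrite mulf_eq0 gt_eqF//= => /eqP -> _.
by rewrite w1 integral0 => /eqP; rewrite onee_eq0.
Qed.

(** Differentiation under the integral sign: the uniform bound on [K'] provides the integrable
    dominating function [|C| * w]. *)
Lemma is_derive_wint (u v a C : R) (K K' : R -> T -> R) : u < a < v ->
  (forall h, u < h < v -> bounded_mfun (K h)) ->
  (forall h x, u < h < v -> is_derive h 1 (K ^~ x) (K' h x)) ->
  (forall h x, u < h < v -> `|K' h x| <= C) ->
  is_derive a 1 (fun h => wint (K h)) (wint (K' a)).
Proof.
move=> uav bK dK K'C.
have C0 : 0 <= `|C| by [].
have dKw h x : u < h < v ->
    is_derive h 1 (fun h => K h x * w x) (K' h x * w x).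
  move=> uhv; have := dK h x uhv => ?.
  apply: is_derive_eq.
  by rewrite scaler0 add0r mulrC.
have d1 h x : u < h < v ->
    partial1of2 (fun h x => K h x * w x) h x = K' h x * w x.
  by move=> uhv; rewrite partial1of2E; have [_ ->] := dKw h x uhv.
have intK h : `]u, v[%classic h ->
    mu.-integrable setT (EFin \o (fun x => K h x * w x)).
  by rewrite /= in_itv/= => uhv; exact/wint_integrable/bK.
have derK h x : `]u, v[%classic h -> [set: T] x ->
    derivable (fun h => K h x * w x) h 1.
  by rewrite /= in_itv/= => uhv _; have [] := dKw h x uhv.
have intC : mu.-integrable setT (EFin \o (fun x => `|C| * w x)).
  by apply: wint_integrable; exact: bounded_mfun_cst.
have C_ge0 x : 0 <= `|C| * w x by rewrite mulr_ge0.
have C_ub h x : `]u, v[%classic h -> [set: T] x ->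
    `|partial1of2 (fun h x => K h x * w x) h x| <= `|C| * w x.
  rewrite /= in_itv/= => uhv _; rewrite d1// normrM (ger0_norm (w_ge0 _)).
  by rewrite ler_wpM2r// (le_trans (K'C _ _ _))// ler_norm.
have Ia : `]u, v[%classic a by rewrite /= in_itv.
apply: DeriveDef.
  exact: (derivable_under_integral measurableT Ia intK derK C_ge0 intC C_ub).
rewrite -derive1E.
rewrite (differentiation_under_integral measurableT Ia intK derK C_ge0 intC C_ub).
by apply: eq_Rintegral => x _; rewrite d1.
Qed.

End weighted_integral.

(** * The Gaussian kernel: growth bounds and derivatives along coordinate lines *)

Section gaussian_kernel.
Context {R : realType} {n : nat}.
Implicit Types (x : 'cV[R]_n) (s : R).

Lemma sqr_l2norm x : l2norm x ^+ 2 = \sum_i (x i 0) ^+ 2.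
Proof. by rewrite sqr_sqrtr// sumr_ge0// => i _; exact: sqr_ge0. Qed.

Lemma sqr_coord_le x i : (x i 0) ^+ 2 <= l2norm x ^+ 2.
Proof.
rewrite sqr_l2norm (bigD1 i)//= lerDl sumr_ge0// => j _; exact: sqr_ge0.
Qed.

Lemma normM_coord_le x i j : `|x i 0 * x j 0| <= l2norm x ^+ 2.
Proof.
have := sqr_coord_le x i; have := sqr_coord_le x j.
rewrite ler_norml; set a := x i 0; set b := x j 0; set c := l2norm x ^+ 2.
by move=> ? ?; apply/andP; split; nra.
Qed.

Lemma norm_coord_le x i : `|x i 0| <= 1 + l2norm x ^+ 2.
Proof.
have := sqr_coord_le x i.
rewrite ler_norml; set a := x i 0; set c := l2norm x ^+ 2.
by move=> ?; apply/andP; split; nra.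
Qed.

Lemma sqr_l2normDevec x i h :
  l2norm (h *: evec R i + x) ^+ 2 = l2norm x ^+ 2 + 2 * h * x i 0 + h ^+ 2.
Proof.
rewrite !sqr_l2norm (bigD1 i)//= [in RHS](bigD1 i)//= !mxE !eqxx mulr1.
rewrite [X in _ + X = _](eq_bigr (fun k => (x k 0) ^+ 2)); last first.
  by move=> k /negbTE ki; rewrite !mxE ki mulr0 add0r.
by ring.
Qed.

(** Left unnormalized, so that it is bounded by 1 for every [s]; the power of [s] is kept apart in
    [gauss_cst]. *)
Definition gker s x (x0 : 'cV[R]_n) : R :=
  expR (- (l2norm (x - x0) ^+ 2 / (2 * s ^+ 2))).

Lemma gker_gt0 s x x0 : 0 < gker s x x0.
Proof. exact: expR_gt0. Qed.

Lemma gker_le1 s x x0 : gker s x x0 <= 1.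
Proof.
by rewrite /gker -expR0 ler_expR oppr_le0 divr_ge0 ?sqr_ge0// mulr_ge0 ?sqr_ge0.
Qed.

(** This is [u * exp (- u) <= 1] at [u = r / (2 s^2)], a consequence of [1 + u <= exp u]. *)
Lemma sqr_l2norm_gker_le s x x0 : 0 < s ->
  l2norm (x - x0) ^+ 2 * gker s x x0 <= 2 * s ^+ 2.
Proof.
move=> s0; rewrite /gker; set r := l2norm _ ^+ 2.
have c0 : 0 < 2 * s ^+ 2 by rewrite mulr_gt0// exprn_gt0.
rewrite expRN ler_pdivrMr ?expR_gt0//.
have := expR_ge1Dx (r / (2 * s ^+ 2)).
rewrite -(ler_pM2l c0); apply: le_trans.
by rewrite mulrDr mulr1 [X in _ + X]mulrC divfK ?gt_eqF// lerDr ltW.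
Qed.

Lemma measurable_sqr_l2norm x :
  measurable_fun setT (fun x0 => l2norm (x - x0) ^+ 2).
Proof.
under eq_fun do rewrite sqr_l2norm.
apply: measurable_sum => i; apply: measurable_funX.
under eq_fun do rewrite !mxE.
by apply: measurable_funB => //; exact: measurable_coord.
Qed.

Lemma measurable_gker s x : measurable_fun setT (gker s x).
Proof.
apply: measurableT_comp => //; apply: measurableT_comp => //.
by apply: measurable_funM => //; exact: measurable_sqr_l2norm.
Qed.

Lemma bounded_gker s x : bounded_mfun (gker s x).
Proof.
split; first exact: measurable_gker.
by exists 1 => x0; rewrite ger0_norm ?gker_le1// ltW// gker_gt0.
Qed.

(** The common source of the boundedness conditions below: the kernel absorbs any factor of at most
    quadratic growth. *)
Lemma norm_gkerM_le s x x0 (a b C : R) : 0 < s -> 0 <= a -> 0 <= b ->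
  `|C| <= a + b * l2norm (x - x0) ^+ 2 ->
  `|C * gker s x x0| <= a + b * (2 * s ^+ 2).
Proof.
move=> s0 a0 b0 Cab.
rewrite normrM (ger0_norm (ltW (gker_gt0 _ _ _))).
apply: (le_trans (ler_wpM2r (ltW (gker_gt0 _ _ _)) Cab)).
rewrite mulrDl lerD//; first by rewrite ler_piMr// gker_le1.
by rewrite -mulrA ler_wpM2l// sqr_l2norm_gker_le.
Qed.

Lemma bounded_sqr_l2norm_gker s x : 0 < s ->
  bounded_mfun (fun x0 => l2norm (x - x0) ^+ 2 * gker s x x0).
Proof.
move=> s0; split.
  by apply: measurable_funM; [exact: measurable_sqr_l2norm|exact: measurable_gker].
exists (0 + 1 * (2 * s ^+ 2)) => x0; apply: norm_gkerM_le => //.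
by rewrite add0r mul1r ger0_norm// sqr_ge0.
Qed.

Lemma bounded_coord_gker s x i : 0 < s ->
  bounded_mfun (fun x0 => (x0 i 0 - x i 0) * gker s x x0).
Proof.
move=> s0; split.
  apply: measurable_funM; last exact: measurable_gker.
  by apply: measurable_funB => //; exact: measurable_coord.
exists (1 + 1 * (2 * s ^+ 2)) => x0; apply: norm_gkerM_le => //.
by have := norm_coord_le (x - x0) i; rewrite !mxE distrC mul1r.
Qed.

Lemma bounded_coord2_gker s x i j : 0 < s ->
  bounded_mfun (fun x0 => (x0 i 0 - x i 0) * (x0 j 0 - x j 0) * gker s x x0).
Proof.
move=> s0; split.
  apply: measurable_funM; last exact: measurable_gker.
  by apply: measurable_funM; apply: measurable_funB => //; exact: measurable_coord.
exists (0 + 1 * (2 * s ^+ 2)) => x0; apply: norm_gkerM_le => //.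
have := normM_coord_le (x - x0) i j; rewrite !mxE mul1r add0r.
by rewrite -(opprB (x0 i 0)) -(opprB (x0 j 0)) mulrNN.
Qed.

Lemma is_derive_gker s x x0 (i : 'I_n) (h : R) : 0 < s ->
  is_derive h 1 (fun h => gker s (h *: evec R i + x) x0)
    ((x0 i 0 - (h + x i 0)) / s ^+ 2 * gker s (h *: evec R i + x) x0).
Proof.
move=> s0; rewrite /gker.
under eq_fun do rewrite -addrA sqr_l2normDevec !mxE.
rewrite -addrA sqr_l2normDevec !mxE.
set r := l2norm (x - x0) ^+ 2; set a := x i 0; set b := x0 i 0.
pose P := fun h : R => - (r + 2 * h * (a - b) + h ^+ 2).
rewrite (_ : (fun h => _) = expR \o (fun h => P h / (2 * s ^+ 2))); last first.
  by apply/funext => k; rewrite /P /= mulNr.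
have dP : is_derive h 1 (fun h => P h / (2 * s ^+ 2))
    (- (2 * (a - b) + 2 * h) / (2 * s ^+ 2)).
  rewrite /P; apply: is_derive_eq.
  rewrite /GRing.scale /=. 
  by field; rewrite gt_eqF.
apply: is_derive_eq; rewrite /P mulNr mulrC; congr (_ * _).
by field; rewrite gt_eqF.
Qed.

(** Both sides have the same difference quotient. This brings directional derivatives within reach
    of the one-variable [is_derive_wint] and of the one-variable chain rule. *)
Lemma is_derive_line (f : 'cV[R]_n -> R) x v (df : R) :
  is_derive x v f df <-> is_derive (0 : R) 1 (fun h => f (h *: v + x)) df.
Proof.
have E : (fun h : R => h^-1 *: ((f \o shift x) (h *: v) - f x)) =
         (fun h : R => h^-1 *: (((fun h => f (h *: v + x)) \o shift 0) (h *: (1 : R))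
                         - f ((0 : R) *: v + x))).
  by apply/funext => h; rewrite /= addr0 scale0r add0r /GRing.scale/= mulr1.
split=> -[D <-]; apply: DeriveDef.
- by rewrite /derivable -E.
- by rewrite /derive -E.
- by rewrite /derivable E.
- by rewrite /derive E.
Qed.

Lemma derive_line (f : 'cV[R]_n -> R) x v (df : R) :
  is_derive (0 : R) 1 (fun h => f (h *: v + x)) df -> 'D_v f x = df.
Proof. by move=> /is_derive_line[]. Qed.

End gaussian_kernel.

Lemma is_derive_quotient {R : realType} (N m z : R -> R) (a dN dm dz c : R) :
  m a != 0 -> is_derive a 1 N dN -> is_derive a 1 m dm -> is_derive a 1 z dz ->
  is_derive a 1 (fun h => (N h / m h - z h) / c)
    ((dN / m a - N a * dm / m a ^+ 2 - dz) / c).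
Proof.
move=> m0 hN [dm1 dm2] hz.
have hV : is_derive a 1 (fun h => (m h)^-1) (- m a ^- 2 * dm).
  by apply: DeriveDef; [exact: derivableV|rewrite deriveV// dm2].
apply: is_derive_eq; rewrite scaler0 add0r /GRing.scale/= mulrC.
by congr (_ / _); ring.
Qed.

(** * Derivatives of the smoothed log-density as posterior moments *)

Section gaussian_smoothing.
Context {R : realType} {n : nat} {p0 : 'cV[R]_n -> R}.
Hypothesis hp0 : is_density p0.
Implicit Types (x : 'cV[R]_n) (s : R).

Let mp0 : measurable_fun setT p0. Proof. by case: hp0. Qed.
Let p0_ge0 x : 0 <= p0 x. Proof. by case: hp0. Qed.
Let p0_1 : (\int[lebesgue_Rn n]_x (p0 x)%:E = 1)%E. Proof. by case: hp0. Qed.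

Local Notation E := (wint (lebesgue_Rn n) p0).

(** Up to normalization, [gker s x * p0] is the law of [x_0] given [x_t = x]; dividing [moment1] and
    [moment2] by [mass] gives the conditional moments of [x_0 - x]. *)
Definition mass s x := E (gker s x).
Definition moment1 s x i := E (fun x0 => (x0 i 0 - x i 0) * gker s x x0).
Definition moment2 s x i j :=
  E (fun x0 => (x0 i 0 - x i 0) * (x0 j 0 - x j 0) * gker s x x0).

Lemma mass_gt0 s x : 0 < mass s x.
Proof.
apply: wint_gt0 => //; first exact: bounded_gker.
exact: gker_gt0.
Qed.

Definition gauss_cst s : R := (2 * pi * s ^+ 2) `^ (- (n%:R / 2)).

Lemma gauss_cst_gt0 s : 0 < s -> 0 < gauss_cst s.
Proof. by move=> s0; rewrite powR_gt0// !mulr_gt0 ?pi_gt0 ?exprn_gt0. Qed.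

Lemma marginalE s x : marginal p0 s x = gauss_cst s * mass s x.
Proof.
rewrite /mass -wintZ//; exact: bounded_gker.
Qed.

Lemma marginal_gt0 s x : 0 < s -> 0 < marginal p0 s x.
Proof. by move=> s0; rewrite marginalE mulr_gt0 ?gauss_cst_gt0 ?mass_gt0. Qed.

Lemma coord_gkerE s x i :
  (fun x0 => x0 i 0 * gker s x x0) =
  (fun x0 => (x0 i 0 - x i 0) * gker s x x0 + x i 0 * gker s x x0).
Proof. by apply/funext => x0; ring. Qed.

Lemma wint_coord_gker s x i : 0 < s ->
  E (fun x0 => x0 i 0 * gker s x x0) = moment1 s x i + x i 0 * mass s x.
Proof.
move=> s0; have bg := bounded_gker s x; have b1 := bounded_coord_gker s x i s0.
rewrite coord_gkerE wintD//; last exact: bounded_mfunZ.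
by rewrite wintZ.
Qed.

Lemma denoiserE s x i : 0 < s ->
  denoiser p0 s x i 0 = x i 0 + moment1 s x i / mass s x.
Proof.
move=> s0; rewrite mxE /denoising_posterior.
have M0 : mass s x != 0 by rewrite gt_eqF// mass_gt0.
have c0 : gauss_cst s != 0 by rewrite gt_eqF// gauss_cst_gt0.
transitivity (E (fun x0 => (mass s x)^-1 * (x0 i 0 * gker s x x0))).
  apply: eq_Rintegral => x0 _.
  rewrite marginalE /gauss -/(gauss_cst s) -/(gker s x x0).
  by field; apply/andP.
rewrite wintZ//; last first.
  rewrite coord_gkerE; apply: bounded_mfunD; first exact: bounded_coord_gker.
  exact/bounded_mfunZ/bounded_gker.
by rewrite wint_coord_gker//; field.
Qed.

(** The growth condition on [q] covers the two cases that occur: [q = 1] for the mass, and [q] the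
    [j]-th coordinate for the uncentred first moment. *)
Lemma is_derive_wint_gker s x i j (q : 'cV[R]_n -> R) : 0 < s ->
  measurable_fun setT q -> (forall x0, `|q x0| <= 1 + `|x0 j 0|) ->
  is_derive x (evec R i) (fun z => E (fun x0 => q x0 * gker s z x0))
    (E (fun x0 => q x0 * ((x0 i 0 - x i 0) / s ^+ 2 * gker s x x0))).
Proof.
move=> s0 mq qj; apply/is_derive_line.
set z := fun h => h *: evec R i + x.
pose K h x0 := q x0 * gker s (z h) x0.
pose K' h x0 := q x0 * ((x0 i 0 - (h + x i 0)) / s ^+ 2 * gker s (z h) x0).
have -> : (fun x0 => q x0 * ((x0 i 0 - x i 0) / s ^+ 2 * gker s x x0)) = K' 0.
  by apply/funext => x0; rewrite /K' /z scale0r !add0r.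
(* For [|h| < 1], replacing [x0 j] by the coordinate of [z h - x0] costs at most [1 + |x j|]; the
   other 1 comes from the bound on [q]. *)
pose C1 := 2 + `|x j 0|.
have C1_ge0 : 0 <= C1 by rewrite addr_ge0.
have coordB h x0 : -1 < h < 1 -> `|q x0| <= C1 + `|(z h - x0) j 0|.
  move=> /andP[h1 h2]; apply: (le_trans (qj x0)).
  have -> : x0 j 0 = - (z h - x0) j 0 + h * (j == i)%:R + x j 0.
    by rewrite !mxE andbT; ring.
  have hd : `|h * (j == i)%:R| <= 1.
    rewrite normrM; case: (j == i); rewrite ?normr0 ?mulr0// normr1 mulr1.
    by rewrite ler_norml !ltW.
  move: (ler_normD (- (z h - x0) j 0 + h * (j == i)%:R) (x j 0)).
  move: (ler_normD (- (z h - x0) j 0) (h * (j == i)%:R)).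
  by rewrite normrN /C1; lra.
(* With [v = z h - x0] and [r = |v|^2], one has [(C1 + |v_j|) * |v_i| <= C1 * (1 + r) + r];
   [norm_gkerM_le] then applies with [a = C1] and [b = C1 + 1], uniformly in [h]. *)
apply: (@is_derive_wint R _ _ (lebesgue_Rn n) p0 mp0 p0_ge0 p0_1 (-1) 1 0
  ((C1 + (C1 + 1) * (2 * s ^+ 2)) / s ^+ 2) K K').
- by rewrite ltrN10 ltr01.
- move=> h h1; split; first by apply: measurable_funM => //; exact: measurable_gker.
  exists ((C1 + 1) + 1 * (2 * s ^+ 2)) => x0; apply: norm_gkerM_le => //.
    by rewrite addr_ge0.
  have := norm_coord_le (z h - x0) j; have := coordB _ x0 h1; lra.
- move=> h x0 _; have := is_derive_gker s x x0 i h s0 => ?.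
  by rewrite /K /K'; apply: is_derive_eq.
- move=> h x0 h1.
  have -> : K' h x0 =
      - (q x0 * (z h - x0) i 0 * gker s (z h) x0) / s ^+ 2.
    by rewrite /K' !mxE eqxx andbT mulr1 -[x0 i 0 - _]opprB; ring.
  rewrite normrM normrN [X in _ * X]ger0_norm ?invr_ge0 ?sqr_ge0//.
  rewrite ler_wpM2r ?invr_ge0 ?sqr_ge0//; apply: norm_gkerM_le => //.
    by rewrite addr_ge0.
  rewrite normrM (le_trans (ler_wpM2r _ (coordB h x0 h1)))//.
  rewrite mulrDl -normrM; have := normM_coord_le (z h - x0) j i.
  by have := ler_wpM2l C1_ge0 (norm_coord_le (z h - x0) i); lra.
Qed.

Lemma is_derive_mass s x i : 0 < s ->
  is_derive x (evec R i) (mass s) (moment1 s x i / s ^+ 2).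
Proof.
move=> s0; have b1 := bounded_coord_gker s x i s0.
have := @is_derive_wint_gker s x i i (fun=> 1) s0 (measurable_cst _).
rewrite /mass; under eq_fun do under eq_fun do rewrite mul1r.
have -> : (fun x0 => 1 * ((x0 i 0 - x i 0) / s ^+ 2 * gker s x x0)) =
    (fun x0 => (s ^+ 2)^-1 * ((x0 i 0 - x i 0) * gker s x x0)).
  by apply/funext => x0; ring.
rewrite wintZ// mulrC; apply => x0.
by rewrite normr1 lerDl.
Qed.

Lemma is_derive_wint_coord_gker s x i j : 0 < s ->
  is_derive x (evec R i) (fun z => E (fun x0 => x0 j 0 * gker s z x0))
    ((moment2 s x i j + x j 0 * moment1 s x i) / s ^+ 2).
Proof.
move=> s0; have b1 := bounded_coord_gker s x i s0.
have b2 := bounded_coord2_gker s x i j s0.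
have := @is_derive_wint_gker s x i j (fun x0 => x0 j 0) s0 (measurable_coord _ _).
have -> : (fun x0 => x0 j 0 * ((x0 i 0 - x i 0) / s ^+ 2 * gker s x x0)) =
    (fun x0 => (s ^+ 2)^-1 * ((x0 i 0 - x i 0) * (x0 j 0 - x j 0) * gker s x x0 +
       x j 0 * ((x0 i 0 - x i 0) * gker s x x0))).
  by apply/funext => x0; ring.
have b3 : bounded_mfun (fun x0 => x j 0 * ((x0 i 0 - x i 0) * gker s x x0)).
  exact: bounded_mfunZ.
rewrite wintZ//; last exact: bounded_mfunD.
rewrite wintD// wintZ// mulrC; apply => x0.
by rewrite lerDr.
Qed.

(** Tweedie's formula. The first moment is left uncentred so that its integrand depends on the base
    point through the kernel alone, ready for a second differentiation. *)
Lemma derive_ln_marginal s x i : 0 < s ->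
  'D_(evec R i) (fun z => ln (marginal p0 s z)) x =
  (E (fun x0 => x0 i 0 * gker s x x0) / mass s x - x i 0) / s ^+ 2.
Proof.
move=> s0; have M0 : mass s x != 0 by rewrite gt_eqF// mass_gt0.
rewrite wint_coord_gker//.
have /is_derive_line dm := is_derive_mass s x i s0.
have c0 := gauss_cst_gt0 s s0.
transitivity ((marginal p0 s x)^-1 * (gauss_cst s * (moment1 s x i / s ^+ 2))).
  apply: derive_line.
  rewrite (_ : (fun h => _) =
     @ln R \o (fun h => gauss_cst s * mass s (h *: evec R i + x))); last first.
    by apply/funext => h; rewrite /= marginalE.
  have dcm : is_derive (0 : R) 1
      (fun h => gauss_cst s * mass s (h *: evec R i + x))
      (gauss_cst s * (moment1 s x i / s ^+ 2)).
    by apply: is_derive_eq.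
  have dln : is_derive (gauss_cst s * mass s ((0 : R) *: evec R i + x)) 1 (@ln R)
      (gauss_cst s * mass s ((0 : R) *: evec R i + x))^-1.
    by apply: is_derive1_ln; rewrite mulr_gt0// mass_gt0.
  by apply: is_derive_eq; rewrite scale0r add0r marginalE.
by rewrite marginalE; field; rewrite M0 !gt_eqF.
Qed.

(** The Hessian is the posterior covariance over [s^4] minus the identity over [s^2]; centring at
    [x] instead of at the posterior mean does not change the covariance. *)
Lemma derive2_ln_marginal s x i j : 0 < s ->
  'D_(evec R i) ('D_(evec R j) (fun z => ln (marginal p0 s z))) x =
  (moment2 s x i j / mass s x - moment1 s x i * moment1 s x j / mass s x ^+ 2)
    / s ^+ 4 - (i == j)%:R / s ^+ 2.
Proof.
move=> s0; have M0 : mass s x != 0 by rewrite gt_eqF// mass_gt0.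
have -> : 'D_(evec R j) (fun z => ln (marginal p0 s z)) =
    (fun z => (E (fun x0 => x0 j 0 * gker s z x0) / mass s z - z j 0) / s ^+ 2).
  by apply/funext => z; exact: derive_ln_marginal.
have /is_derive_line dm := is_derive_mass s x i s0.
have /is_derive_line dN := is_derive_wint_coord_gker s x i j s0.
have dz : is_derive (0 : R) 1 (fun h => (h *: evec R i + x) j 0) (i == j)%:R.
  under eq_fun do rewrite !mxE andbT.
  by apply: is_derive_eq; rewrite scaler0 add0r addr0 /GRing.scale/= mulr1 eq_sym.
have mn0 : mass s ((0 : R) *: evec R i + x) != 0 by rewrite scale0r add0r.
have dq := is_derive_quotient _ _ _ _ _ _ _ (s ^+ 2) mn0 dN dm dz.
rewrite (derive_line _ _ _ _ dq).
rewrite scale0r add0r wint_coord_gker//.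
by field; rewrite M0 gt_eqF.
Qed.

End gaussian_smoothing.

(** * Limits from the right at 0, along the schedule, and of finite sums *)

Lemma cvg_at_right_gt0 {R : realType} {T : Type} (F : set_system T)
    {FF : Filter F} (f : T -> R) :
  (\forall t \near F, 0 < f t) -> f t @[t --> F] --> (0 : R) ->
  f t @[t --> F] --> (0 : R)^'+.
Proof.
move=> f0 cf A [e /= e0 eA].
have /cvgrPdist_lt/(_ _ e0) fe := cf.
by near=> t; apply: eA => /=; near: t.
Unshelve. all: by end_near. Qed.

(* By the intermediate value theorem the schedule takes every small positive
   value, so a limit along the schedule is a limit in the noise level. *)
Lemma noise_schedule_cvg {R : realType} {T : nbhsType} (sigma : R -> R)
    (f : R -> T) (l : T) : noise_schedule sigma ->
  f (sigma t) @[t --> 0^'+] --> l -> f s @[s --> 0^'+] --> l.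
Proof.
move=> [sigma_gt0 csigma sigma0] fl A /fl [e /= e0 eA].
pose t0 := e / 2.
have t00 : 0 < t0 by rewrite divr_gt0.
have t0e : t0 < e by rewrite /t0; lra.
suff : \forall s \near (0 : R)^'+, A (f s) by [].
near=> s.
have s0 : 0 < s by near: s; exact: nbhs_right_gt.
have st0 : s < sigma t0.
  by near: s; apply: nbhs_right_lt; exact: sigma_gt0.
have [t1 /and3P[t10 t1t0 st1]] : exists t1, [&& 0 < t1, t1 < t0 & sigma t1 < s].
  have sigma_lt : \forall t \near (0 : R)^'+, sigma t < s.
    exact: (cvgr_lt _ sigma0).
  near (0 : R)^'+ => t1; exists t1; apply/and3P; split; near: t1.
  - exact: nbhs_right_gt.
  - exact: nbhs_right_lt.
  - exact: sigma_lt.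
have [|||t] := @IVT R sigma t1 t0 s.
- exact: ltW.
- apply: continuous_in_subspaceT => t /set_mem /=; rewrite in_itv/= => /andP[t1t _].
  by apply: csigma; exact: lt_le_trans t1t.
- by rewrite ge_min le_max (ltW st1) (ltW st0) orbT.
rewrite in_itv/= => /andP[t1t tt0] <-; apply: eA => /=.
  by rewrite sub0r normrN gtr0_norm ?(lt_le_trans t10)// (le_lt_trans tt0).
exact: lt_le_trans t1t.
Unshelve. all: by end_near. Qed.

Lemma cvg_sumr {R : realType} {T : Type} (F : set_system T) {FF : Filter F}
    (I : Type) (r : seq I) (f : I -> T -> R) (l : I -> R) :
  (forall i, f i t @[t --> F] --> l i) ->
  \sum_(i <- r) f i t @[t --> F] --> \sum_(i <- r) l i.
Proof.
move=> fl; elim: r => [|i r IHr].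
  by rewrite big_nil; under eq_fun do rewrite big_nil; exact: cvg_cst.
by rewrite big_cons; under eq_fun do rewrite big_cons; apply: cvgD.
Qed.

Lemma cvg_l2norm_sqr {R : realType} {T : Type} (F : set_system T) {FF : Filter F}
    (n : nat) (f : T -> 'cV[R]_n) (v : 'cV[R]_n) :
  (forall i, f t i 0 @[t --> F] --> v i 0) ->
  l2norm (f t) ^+ 2 @[t --> F] --> l2norm v ^+ 2.
Proof.
move=> fv; rewrite sqr_l2norm; under eq_fun do rewrite sqr_l2norm.
apply: cvg_sumr => i; under eq_fun do rewrite expr2.
by rewrite expr2; apply: cvgM.
Qed.

(** * The Tauberian argument for the normalized second moment *)

Section small_noise.
Context {R : realType} {n : nat} {p0 : 'cV[R]_n -> R}.
Hypothesis hp0 : is_density p0.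
Implicit Types (x : 'cV[R]_n) (s k : R).

Let mp0 : measurable_fun setT p0. Proof. by case: hp0. Qed.
Let p0_ge0 x : 0 <= p0 x. Proof. by case: hp0. Qed.
Let p0_1 : (\int[lebesgue_Rn n]_x (p0 x)%:E = 1)%E. Proof. by case: hp0. Qed.

Local Notation E := (wint (lebesgue_Rn n) p0).
Local Notation mass := (@mass R n p0).
Local Notation moment1 := (@moment1 R n p0).
Local Notation moment2 := (@moment2 R n p0).

Definition energy s x := E (fun x0 => l2norm (x - x0) ^+ 2 * gker s x x0).

(* The normalized second moment E[|x_0 - x|^2 | x_t = x] / s^2. *)
Definition qenergy s x := energy s x / (s ^+ 2 * mass s x).

Lemma sum_moment2 s x : 0 < s -> \sum_i moment2 s x i i = energy s x.
Proof.
move=> s0; rewrite /moment2 -wint_sum//; last first.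
  by move=> i; exact: bounded_coord2_gker.
congr wint; apply/funext => x0; rewrite -mulr_suml sqr_l2norm; congr (_ * _).
by apply: eq_bigr => i _; rewrite !mxE -expr2 -sqrrN opprB.
Qed.

(* e^u >= 1 + u: the mass is convex as a function of 1 / (2 s^2), with
   derivative -energy. *)
Lemma mass_tangent s k x : 0 < s -> 0 < k ->
  (1 - k ^- 2) / (2 * s ^+ 2) * energy s x <= mass (k * s) x - mass s x.
Proof.
move=> s0 k0; have bg := bounded_gker.
have be := bounded_sqr_l2norm_gker s x s0.
rewrite -wintZ// -wintB//; apply: le_wint => //.
- exact: bounded_mfunZ.
- exact: bounded_mfunB.
move=> x0; set r := l2norm _ ^+ 2; rewrite mulrA [_ * r]mulrC.
set u := r * _.
have -> : gker (k * s) x x0 = expR u * gker s x x0.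
  rewrite /gker -expRD; congr expR; rewrite /u -/r.
  by field; rewrite !gt_eqF.
rewrite -[X in _ - X]mul1r -mulrBl ler_wpM2r ?(ltW (gker_gt0 _ _ _))//.
by rewrite lerBrDl expR_ge1Dx.
Qed.

(** The factor [1 - k^-2] changes sign at [k = 1]: this bounds [qenergy] from above for [k > 1] and
    from below for [k < 1]. *)
Lemma qenergy_tangent s k x : 0 < s -> 0 < k ->
  (1 - k ^- 2) * qenergy s x <= 2 * (mass (k * s) x / mass s x - 1).
Proof.
move=> s0 k0; have M0 := mass_gt0 hp0 s x.
have := mass_tangent s k x s0 k0.
rewrite -(ler_pM2r (_ : 0 < 2 / mass s x)); last by rewrite divr_gt0.
congr (_ <= _); rewrite /qenergy.
  by field; rewrite !gt_eqF.
by field; rewrite !gt_eqF.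
Qed.

(** The normalizing constant scales as [s^-n], which is where the limit [k^n] of the mass ratio
    comes from. *)
Lemma gauss_cst_scale k s : 0 < k -> 0 < s ->
  k ^+ n * @gauss_cst R n (k * s) = @gauss_cst R n s.
Proof.
move=> k0 s0; have k_neq0 : k ^+ n != 0 by rewrite expf_neq0// gt_eqF.
have kn : (k ^+ 2) `^ (- (n%:R / 2)) = (k ^+ n)^-1.
  rewrite -[k ^+ 2](powR_mulrn 2 (ltW k0)) -powRrM mulrN powRN mulrC divfK//.
  by rewrite powR_mulrn// ltW.
have c0 : 0 <= 2 * pi * s ^+ 2 :> R by rewrite mulr_ge0 ?sqr_ge0// mulr_ge0// pi_ge0.
rewrite /gauss_cst exprMn [2 * pi * (_ * _)]mulrCA (powRM _ (sqr_ge0 k) c0).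
by rewrite kn mulVKf.
Qed.

Variables (x : 'cV[R]_n) (L : R).
Hypothesis L_gt0 : 0 < L.
Hypothesis marginal_cvg : marginal p0 s x @[s --> 0^'+] --> L.

(** The marginals at noise levels [k * s] and [s] have the same nonzero limit [L], so their quotient
    tends to 1 and only the ratio of the normalizing constants remains. *)
Lemma mass_ratio_cvg k : 0 < k ->
  mass (k * s) x / mass s x @[s --> 0^'+] --> k ^+ n.
Proof.
move=> k0.
have ks0 : k * s @[s --> 0^'+] --> (0 : R)^'+.
  apply: cvg_at_right_gt0.
    by near=> s; rewrite mulr_gt0//; near: s; exact: nbhs_right_gt.
  rewrite -[X in _ --> X](mulr0 k); apply: cvgM; first exact: cvg_cst.
  exact: cvg_at_right_filter.
have mk := cvg_comp _ _ ks0 marginal_cvg.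
have : k ^+ n * (marginal p0 (k * s) x / marginal p0 s x) @[s --> 0^'+]
    --> k ^+ n * (L / L).
  apply: cvgM; first exact: cvg_cst.
  by apply: cvgM; [exact: mk|apply: cvgV => //; rewrite gt_eqF].
rewrite divff ?gt_eqF// mulr1; apply: cvg_trans; apply: near_eq_cvg.
near=> s.
have s0 : 0 < s by near: s; exact: nbhs_right_gt.
have M0 := mass_gt0 hp0 s x.
rewrite !marginalE// -(gauss_cst_scale k s)//.
have c0 : gauss_cst (k * s) > 0 := @gauss_cst_gt0 R n _ (mulr_gt0 k0 s0).
by field; rewrite !gt_eqF// exprn_gt0.
Unshelve. all: by end_near. Qed.

(* The difference quotient between 1 and k of k^n with respect to -1/(2 k^2),
   cleared of its singularity at k = 1. *)
Definition slope k : R := 2 * k ^+ 2 * (\sum_(i < n) 'X^i).[k] / (k + 1).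

Lemma slopeE k : 0 < k -> (1 - k ^- 2) * slope k = 2 * (k ^+ n - 1).
Proof.
move=> k0; rewrite subrX1 /slope horner_sum.
under eq_bigr do rewrite hornerXn.
by field; rewrite !gt_eqF// addr_gt0.
Qed.

Lemma slope_cvg : slope k @[k --> (1 : R)] --> (n%:R : R).
Proof.
have -> : (n%:R : R) = slope 1.
  rewrite /slope horner_sum (eq_bigr (fun=> 1)); last first.
    by move=> i _; rewrite hornerXn expr1n.
  by rewrite sumr_const card_ord expr1n mulr1; field.
apply: cvgM; last first.
  by apply: cvgV; [rewrite gt_eqF|apply: cvgD; [exact: cvg_id|exact: cvg_cst]].
apply: cvgM; last exact: continuous_horner.
apply: cvgM; first exact: cvg_cst.
exact: exprn_continuous.
Qed.

Lemma qenergy_cvg : qenergy s x @[s --> 0^'+] --> (n%:R : R).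
Proof.
apply/cvgrPdist_lt => e e0.
have slope_near : \forall k \near (1 : R), `|n%:R - slope k| < e.
  by have /cvgrPdist_lt := slope_cvg; apply.
have ratio_cvg k : 0 < k -> 2 * (mass (k * s) x / mass s x - 1) @[s --> 0^'+]
    --> (1 - k ^- 2) * slope k.
  move=> k0; rewrite slopeE//; apply: cvgM; first exact: cvg_cst.
  by apply: cvgB; [exact: mass_ratio_cvg|exact: cvg_cst].
(* The scales [k1 > 1] and [k2 < 1] are fixed in terms of [e] before [s] goes to 0, so no uniformity
   in [k] is called for. *)
have [k1 k1_gt1 k1e] : exists2 k, 1 < k & `|n%:R - slope k| < e.
  near (1 : R)^'+ => k; exists k; first by near: k; exact: nbhs_right_gt.
  by near: k; exact: cvg_within slope_near.
have [k2 /andP[k2_gt0 k2_lt1] k2e] : exists2 k, 0 < k < 1 & `|n%:R - slope k| < e.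
  near (1 : R)^'- => k; exists k.
    by apply/andP; split; near: k; [exact: nbhs_left_gt|exact: nbhs_left_lt].
  by near: k; exact: cvg_within slope_near.
have k1_gt0 : 0 < k1 by exact: lt_trans k1_gt1.
have c1 : 0 < 1 - k1 ^- 2 by rewrite subr_gt0 invf_lt1 ?exprn_gt0// exprn_egt1.
have c2 : 0 < k2 ^- 2 - 1 by rewrite subr_gt0 invf_gt1 ?exprn_gt0// exprn_ilt1// ltW.
have up : \forall s \near (0 : R)^'+,
    2 * (mass (k1 * s) x / mass s x - 1) < (1 - k1 ^- 2) * (n%:R + e).
  apply: (cvgr_lt _ (ratio_cvg _ k1_gt0)); rewrite ltr_pM2l//.
  by move: k1e; rewrite ltr_norml => /andP[]; lra.
(* Here [1 - k2^-2] is negative: an upper bound on the product is a lower bound on [qenergy]. *)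
have lo : \forall s \near (0 : R)^'+,
    2 * (mass (k2 * s) x / mass s x - 1) < (1 - k2 ^- 2) * (n%:R - e).
  apply: (cvgr_lt _ (ratio_cvg _ k2_gt0)).
  rewrite -(opprB _ 1) !mulNr ltrN2 ltr_pM2l//.
  by move: k2e; rewrite ltr_norml => /andP[]; lra.
near=> s.
have s0 : 0 < s by near: s; exact: nbhs_right_gt.
have q1 : (1 - k1 ^- 2) * qenergy s x < (1 - k1 ^- 2) * (n%:R + e).
  by apply: le_lt_trans (qenergy_tangent s k1 x s0 k1_gt0) _; near: s.
have q2 : (1 - k2 ^- 2) * qenergy s x < (1 - k2 ^- 2) * (n%:R - e).
  by apply: le_lt_trans (qenergy_tangent s k2 x s0 k2_gt0) _; near: s.
move: q1 q2; rewrite ltr_pM2l// -(opprB _ 1) !mulNr ltrN2 ltr_pM2l// => q1 q2.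
by rewrite ltr_norml; apply/andP; split; lra.
Unshelve. all: by end_near. Qed.

End small_noise.

(** * Limits of the denoiser and of the derivative terms *)

Section vml_limit.
Context {R : realType} {n : nat} {p0 : 'cV[R]_n -> R}.
Hypothesis hp0 : is_density p0.
Variables (x : 'cV[R]_n) (L : R).
Hypothesis L_gt0 : 0 < L.
Hypothesis marginal_cvg : marginal p0 s x @[s --> 0^'+] --> L.

Let mp0 : measurable_fun setT p0. Proof. by case: hp0. Qed.
Let p0_ge0 z : 0 <= p0 z. Proof. by case: hp0. Qed.
Let p0_1 : (\int[lebesgue_Rn n]_z (p0 z)%:E = 1)%E. Proof. by case: hp0. Qed.

Local Notation mass := (@mass R n p0).
Local Notation moment1 := (@moment1 R n p0).
Local Notation moment2 := (@moment2 R n p0).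
Local Notation energy := (@energy R n p0).
Local Notation qenergy := (@qenergy R n p0).
Local Notation logp s := (fun z => ln (marginal p0 s z)).

Let qcvg := qenergy_cvg hp0 x L L_gt0 marginal_cvg.

Lemma cvg_at_right_id : s @[s --> 0^'+] --> (0 : R).
Proof. exact: cvg_at_right_filter. Qed.

Lemma normr_wint_le (K M : 'cV[R]_n -> R) : bounded_mfun K -> bounded_mfun M ->
  (forall z, `|K z| <= M z) ->
  `|wint (lebesgue_Rn n) p0 K| <= wint (lebesgue_Rn n) p0 M.
Proof.
move=> bK bM KM; rewrite ler_norml -mulN1r -wintZ//.
have bNM := bounded_mfunZ (-1) M bM.
apply/andP; split; apply: le_wint => // z; have := KM z; rewrite ler_norml.
  by rewrite mulN1r => /andP[].
by move=> /andP[].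
Qed.

(** Integrate the pointwise bound [|z_i - x_i| <= s + |x - z|^2 / s] against the kernel; the weight
    [s] balances the two terms, as the energy is of order [s^2] times the mass. *)
Lemma norm_moment1_le s i : 0 < s ->
  `|moment1 s x i / mass s x| <= s * (1 + qenergy s x).
Proof.
move=> s0; have M0 := mass_gt0 hp0 s x.
rewrite normrM [X in _ * X]gtr0_norm ?invr_gt0// ler_pdivrMr//.
have bg := bounded_gker s x; have be := bounded_sqr_l2norm_gker s x s0.
have -> : s * (1 + qenergy s x) * mass s x =
    wint (lebesgue_Rn n) p0 (fun z => s * gker s x z
      + s^-1 * (l2norm (x - z) ^+ 2 * gker s x z)).
  rewrite wintD ?wintZ//; [|exact: bounded_mfunZ..].
  by rewrite -/(mass s x) -/(energy s x) /qenergy; field; rewrite !gt_eqF.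
apply: normr_wint_le; first exact: bounded_coord_gker.
  by apply: bounded_mfunD; exact: bounded_mfunZ.
move=> z; rewrite mulrA -mulrDl normrM (gtr0_norm (gker_gt0 _ _ _)).
rewrite ler_wpM2r ?(ltW (gker_gt0 _ _ _))//.
have := sqr_coord_le (x - z) i; rewrite !mxE.
set a := z i 0; set b := x i 0; set r := l2norm _ ^+ 2 => abr.
(* After multiplication by [s] the bound follows from the squares of [s - (a - b)] and [s + (a - b)]
   being nonnegative. *)
rewrite -(ler_pM2l s0) mulrDr mulVKf ?gt_eqF//.
rewrite -[X in X * `|_|]gtr0_norm// -normrM ler_norml.
have := sqr_ge0 (s - (a - b)); have := sqr_ge0 (s + (a - b)).
have := sqr_ge0 s; have := sqr_ge0 (a - b).
by move=> *; apply/andP; split; nra.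
Qed.

Lemma norm_moment2_le s i j : 0 < s ->
  `|moment2 s x i j / mass s x| <= s ^+ 2 * qenergy s x.
Proof.
move=> s0; have M0 := mass_gt0 hp0 s x.
rewrite normrM [X in _ * X]gtr0_norm ?invr_gt0// ler_pdivrMr//.
have -> : s ^+ 2 * qenergy s x * mass s x = energy s x.
  by rewrite /qenergy; field; rewrite !gt_eqF.
apply: normr_wint_le; first exact: bounded_coord2_gker.
  exact: bounded_sqr_l2norm_gker.
move=> z; rewrite normrM (gtr0_norm (gker_gt0 _ _ _)).
rewrite ler_wpM2r ?(ltW (gker_gt0 _ _ _))//.
have := normM_coord_le (x - z) i j; rewrite !mxE.
by rewrite -(opprB (z i 0)) -(opprB (z j 0)) mulrNN.
Qed.

Lemma squeeze0 (f g : R -> R) : (forall s, 0 < s -> `|f s| <= g s) ->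
  g s @[s --> 0^'+] --> (0 : R) -> f s @[s --> 0^'+] --> (0 : R).
Proof.
move=> fg g0; apply: norm_cvg0.
apply: (squeeze_cvgr _ (cvg_cst 0) g0); near=> s.
by rewrite normr_ge0 fg//; near: s; exact: nbhs_right_gt.
Unshelve. all: by end_near. Qed.

Lemma moment1_cvg i : moment1 s x i / mass s x @[s --> 0^'+] --> (0 : R).
Proof.
apply: (squeeze0 _ _ (norm_moment1_le ^~ i)).
rewrite -[X in _ --> X](mul0r (1 + n%:R)).
apply: cvgM; first exact: cvg_at_right_id.
by apply: cvgD; [exact: cvg_cst|exact: qcvg].
Qed.

Lemma moment2_cvg i j : moment2 s x i j / mass s x @[s --> 0^'+] --> (0 : R).
Proof.
apply: (squeeze0 _ _ (fun s => norm_moment2_le s i j)).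
rewrite -[X in _ --> X](mul0r n%:R) -[X in X * _](mul0r 0).
under eq_fun do rewrite expr2.
by apply: cvgM; [apply: cvgM; exact: cvg_at_right_id|exact: qcvg].
Qed.

Lemma denoiser_cvg i : denoiser p0 s x i 0 @[s --> 0^'+] --> x i 0.
Proof.
have : x i 0 + moment1 s x i / mass s x @[s --> 0^'+] --> x i 0 + 0.
  by apply: cvgD; [exact: cvg_cst|exact: moment1_cvg].
rewrite addr0; apply: cvg_trans; apply: near_eq_cvg; near=> s.
by rewrite denoiserE//; near: s; exact: nbhs_right_gt.
Unshelve. all: by end_near. Qed.

(** The factor [s^4] cancels the denominator of the covariance term, leaving the posterior
    covariance minus [s^2] times the identity; both vanish in the limit. *)
Lemma hessian_cvg i j : s ^+ 4 * hessian (logp s) x i j @[s --> 0^'+] --> (0 : R).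
Proof.
have : moment2 s x i j / mass s x
    - moment1 s x i / mass s x * (moment1 s x j / mass s x)
    - s ^+ 2 * (i == j)%:R @[s --> 0^'+] -->
      (0 - 0 * 0 - 0 * 0 * (i == j)%:R : R).
  apply: cvgB; first apply: cvgB; first exact: moment2_cvg.
    by apply: cvgM; exact: moment1_cvg.
  under eq_fun do rewrite expr2.
  by apply: cvgM; [apply: cvgM; exact: cvg_at_right_id|exact: cvg_cst].
rewrite !mul0r !subr0; apply: cvg_trans; apply: near_eq_cvg; near=> s.
have s0 : 0 < s by near: s; exact: nbhs_right_gt.
have M0 := mass_gt0 hp0 s x.
by rewrite mxE derive2_ln_marginal//; field; rewrite !gt_eqF.
Unshelve. all: by end_near. Qed.

(* This is s^2 times (Laplacian of p_t) / p_t: the squared gradient and the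
   trace of the Hessian of log p_t need not be controlled separately. *)
Lemma gradient_hessianE s : 0 < s ->
  s ^+ 2 * (l2norm (gradient (logp s) x) ^+ 2 + \tr (hessian (logp s) x)) =
  qenergy s x - n%:R.
Proof.
move=> s0; have M0 := mass_gt0 hp0 s x.
rewrite /mxtrace sqr_l2norm -big_split/= mulr_sumr.
(* In each coordinate the squared gradient cancels the squared first moment in the Hessian, so only
   the second moment survives. *)
rewrite (eq_bigr (fun i => (s ^+ 2 * mass s x)^-1 * moment2 s x i i - 1)).
  by rewrite sumrB -mulr_sumr sum_moment2// sumr_const card_ord mulrC.
move=> i _; rewrite !mxE derive_ln_marginal// wint_coord_gker//.
rewrite derive2_ln_marginal// eqxx mulr1n.
by field; rewrite !gt_eqF.
Qed.

(** * The measurement terms and the limit in the noise level *)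

Section measurement.
Variables (m : nat) (H : 'M[R]_(m, n)) (sy : R) (y : 'cV[R]_m).
Hypothesis sy_gt0 : 0 < sy.

Lemma likelihood_gt0 z : 0 < likelihood H sy y z.
Proof.
by rewrite mulr_gt0 ?expR_gt0// powR_gt0// !mulr_gt0 ?pi_gt0// exprn_gt0.
Qed.

Lemma bounded_likelihood : bounded_mfun (likelihood H sy y).
Proof.
apply: bounded_mfunZ; split.
  apply: measurableT_comp => //; apply: measurableT_comp => //.
  apply: measurable_funM => //; under eq_fun do rewrite sqr_l2norm.
  apply: measurable_sum => i; apply: measurable_funX.
  under eq_fun do rewrite !mxE; apply: measurable_funB => //.
  apply: measurable_sum => j; apply: measurable_funM => //.
  exact: measurable_coord.
exists 1 => z; rewrite ger0_norm ?(ltW (expR_gt0 _))// -expR0 ler_expR oppr_le0.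
by rewrite divr_ge0 ?sqr_ge0// mulr_ge0 ?sqr_ge0.
Qed.

Lemma evidence_gt0 : 0 < evidence p0 H sy y.
Proof.
apply: wint_gt0 => //; first exact: bounded_likelihood.
exact: likelihood_gt0.
Qed.

Lemma ln_likelihood z : ln (likelihood H sy y z) =
  - (m%:R / 2 * ln (2 * pi)) - m%:R * ln sy
  - l2norm (y - H *m z) ^+ 2 / (2 * sy ^+ 2).
Proof.
have pi2 : 0 < 2 * pi :> R by rewrite mulr_gt0 ?pi_gt0.
have sy2 : 0 < sy ^+ 2 by rewrite exprn_gt0.
have c0 : 0 < 2 * pi * sy ^+ 2 by rewrite mulr_gt0.
rewrite /likelihood /gauss lnM ?posrE ?expR_gt0 ?powR_gt0// expRK.
rewrite ln_powR lnM ?posrE// lnXn// -mulr_natr.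
by field; rewrite gt_eqF.
Qed.

Lemma residual_cvg : l2norm (y - H *m denoiser p0 s x) ^+ 2 @[s --> 0^'+]
  --> l2norm (y - H *m x) ^+ 2.
Proof.
apply: cvg_l2norm_sqr => i.
rewrite !mxE; under eq_fun do rewrite !mxE.
apply: cvgB; first exact: cvg_cst.
apply: cvg_sumr => j; apply: cvgM; first exact: cvg_cst.
exact: denoiser_cvg.
Qed.

Lemma trace_hessian_cvg :
  s ^+ 4 * \tr (H *m hessian (logp s) x *m H^T) @[s --> 0^'+] --> (0 : R).
Proof.
have -> : (fun s => s ^+ 4 * \tr (H *m hessian (logp s) x *m H^T)) =
    (fun s => \sum_i \sum_j
      (\sum_k H i k * (s ^+ 4 * hessian (logp s) x k j)) * H i j).
  apply/funext => s; rewrite /mxtrace mulr_sumr; apply: eq_bigr => i _.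
  rewrite mxE mulr_sumr; apply: eq_bigr => j _.
  rewrite mxE [H^T _ _]mxE mulrA mulr_sumr; congr (_ * _).
  by apply: eq_bigr => k _; rewrite mulrCA.
rewrite [X in _ --> X](_ : _ =
    \sum_(i < m) \sum_(j < n) (\sum_(k < n) H i k * 0) * H i j); last first.
  rewrite big1// => i _; rewrite big1// => j _; rewrite big1 ?mul0r// => k _.
  by rewrite mulr0.
apply: cvg_sumr => i; apply: cvg_sumr => j; apply: cvgM; last exact: cvg_cst.
apply: cvg_sumr => k; apply: cvgM; first exact: cvg_cst.
exact: hessian_cvg.
Qed.

Lemma VML_cvg :
  VML p0 H sy y s x + n%:R * ln s @[s --> 0^'+] -->
  - ln (likelihood H sy y x * L / evidence p0 H sy y) + CVML_hat R n.
Proof.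
have ev0 := evidence_gt0.
have lk0 := likelihood_gt0 x.
pose c : R := (2 * sy ^+ 2)^-1.
(* The loss regrouped: the gradient and Laplacian terms merge into [qenergy - n], which tends to 0,
   and [n * ln s] has cancelled the divergent term. *)
have : - ln (marginal p0 s x) - 2^-1 * (qenergy s x - n%:R)
    + l2norm (y - H *m denoiser p0 s x) ^+ 2 * c
    + c * (s ^+ 4 * \tr (H *m hessian (logp s) x *m H^T))
    + s * s * (c * \tr (H *m H^T))
    + (ln (evidence p0 H sy y) + CVML n m sy) @[s --> 0^'+] -->
    - ln L - 2^-1 * (n%:R - n%:R) + l2norm (y - H *m x) ^+ 2 * c + c * 0
    + 0 * 0 * (c * \tr (H *m H^T)) + (ln (evidence p0 H sy y) + CVML n m sy).
  apply: cvgD; last exact: cvg_cst.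
  apply: cvgD; last first.
    by apply: cvgM; [apply: cvgM; exact: cvg_at_right_id|exact: cvg_cst].
  apply: cvgD; last by apply: cvgM; [exact: cvg_cst|exact: trace_hessian_cvg].
  apply: cvgD; last by apply: cvgM; [exact: residual_cvg|exact: cvg_cst].
  apply: cvgB.
    by apply: cvgN; apply: continuous_cvg => //; exact: continuous_ln.
  apply: cvgM; first exact: cvg_cst.
  by apply: cvgB; [exact: qcvg|exact: cvg_cst].
(* The normalization of the likelihood, in [m], [sy] and [2 * pi], makes up the difference between
   [CVML] and [CVML_hat]. *)
have -> : - ln L - 2^-1 * (n%:R - n%:R) + l2norm (y - H *m x) ^+ 2 * c + c * 0
    + 0 * 0 * (c * \tr (H *m H^T)) + (ln (evidence p0 H sy y) + CVML n m sy) =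
    - ln (likelihood H sy y x * L / evidence p0 H sy y) + CVML_hat R n.
  rewrite ln_div ?posrE//; last exact: mulr_gt0.
  rewrite lnM ?posrE//.
  by rewrite ln_likelihood /CVML /CVML_hat /c; lra.
apply: cvg_trans; apply: near_eq_cvg; near=> s.
have s0 : 0 < s by near: s; exact: nbhs_right_gt.
rewrite -gradient_hessianE// /VML /c.
by ring.
Unshelve. all: by end_near. Qed.

End measurement.
End vml_limit.

(** * The limit along the schedule *)

Theorem propositionB2 (R : realType) (n m : nat)
    (p0 : 'cV[R]_n -> R) (sigma : R -> R)
    (H : 'M[R]_(m, n)) (y : 'cV[R]_m) (sigma_y : R) (tau d : R)
    (p0_density : is_density p0)
    (sigma_schedule : noise_schedule sigma)
    (sigma_y_gt0 : 0 < sigma_y)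
    (tau_gt0 : 0 < tau) (d_gt0 : 0 < d)
    (pt_C2 : forall t, 0 < t < tau -> C2 (marginal p0 (sigma t))) :
  forall x : 'cV[R]_n, l2norm x <= d ->
    0 < p0 x ->
    ln (marginal p0 (sigma t) x) @[t --> 0^'+] --> ln (p0 x) ->
    VML p0 H sigma_y y (sigma t) x + n%:R * ln (sigma t) @[t --> 0^'+]
      --> - ln (posterior p0 H sigma_y y x) + CVML_hat R n.
Proof.
move=> x _ p0x_gt0 logp_cvg.
have ln_cvg := noise_schedule_cvg sigma (fun s => ln (marginal p0 s x)) _
  sigma_schedule logp_cvg.
have marginal_cvg : marginal p0 s x @[s --> 0^'+] --> p0 x.
  (* Convergence of logarithms is exponentiated; positivity of [p0 x] matters because [ln] takes the
     default value 0 at nonpositive arguments. *)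
  rewrite -(lnK (x := p0 x)) ?posrE//.
  have : expR (ln (marginal p0 s x)) @[s --> 0^'+] --> expR (ln (p0 x)).
    by apply: continuous_cvg => //; exact: continuous_expR.
  apply: cvg_trans; apply: near_eq_cvg; near=> s.
  rewrite lnK// posrE; apply: (marginal_gt0 p0_density).
  by near: s; exact: nbhs_right_gt.
have [sigma_gt0 _ sigma0] := sigma_schedule.
(* The way back from noise levels to times: composing with the schedule uses that it tends to 0
   through positive values. *)
have sigma_cvg : sigma t @[t --> 0^'+] --> (0 : R)^'+.
  apply: cvg_at_right_gt0 => //; near=> t; apply: sigma_gt0.
  by near: t; exact: nbhs_right_gt.
exact: (cvg_comp _ _ sigma_cvg
  (VML_cvg p0_density x _ p0x_gt0 marginal_cvg m H sigma_y y sigma_y_gt0)).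
Unshelve. all: by end_near. Qed.
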